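(* Let $u,v\in\mathbb{R}$, $\alpha>0$, $\theta\in(-\pi/2,\pi/2)$, $\sigma,\eta\in\{1,-1\}$, $u_0,v_0\in\mathbb{R}$ and $t_1<t_2$, and suppose that the curve $$\begin{pmatrix} x(t)\\ y(t)\end{pmatrix}=\frac{1}{\alpha^2}\begin{pmatrix}\cos\theta&-\sin\theta\\ \sin\theta&\cos\theta\end{pmatrix}\begin{pmatrix}\sigma&0\\0&\eta\end{pmatrix}\begin{pmatrix} f(\alpha t)+u_0\,\alpha t\\ g(\alpha t)+v_0\,\alpha t\end{pmatrix}$$ satisfies the boundary conditions $$(x'(t_1),y'(t_1))=(u,v),\qquad (x'(t_2),y'(t_2))=(u+1,v),\qquad (x(t_2)-x(t_1),\,y(t_2)-y(t_1))=(\delta_x,\delta_y)$$ for given $(\delta_x,\delta_y)\in\mathbb{R}^2$. Then $\alpha<\Lambda(t_2-t_1,\theta)$.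
   Context: The functions $f,g:\mathbb{R}\to\mathbb{R}$ are $f(t)=t\,\mathrm{arcsinh}(t)-\sqrt{1+t^2}$ and $g(t)=\frac12\left(t\sqrt{1+t^2}+\mathrm{arcsinh}(t)\right)$, so that $f'(t)=\mathrm{arcsinh}(t)$ and $g'(t)=\sqrt{1+t^2}$. For $T>1$ and $-\pi/2<\theta<\pi/2$, define $$\Lambda(T,\theta)=\sup\{\alpha>0 : \alpha T>\exp(\alpha\cos\theta/2)-1\}.$$ (Under the hypotheses of the claim $t_2-t_1>1$, because the curve has non-constant acceleration of magnitude $1$ and its velocity changes by a vector of length $1$; so $\Lambda(t_2-t_1,\theta)$ is defined.) *)

(* Defs.v *)
From Stdlib Require Import Reals Lra Psatz.
From Coquelicot Require Import Coquelicot.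
Local Open Scope R_scope.

Definition f (t : R) : R := t * arcsinh t - sqrt (1 + t ^ 2).
Definition g (t : R) : R := (t * sqrt (1 + t ^ 2) + arcsinh t) / 2.

Definition Lambda_set (T theta : R) : R -> Prop :=
  fun alpha => alpha > 0 /\ alpha * T > exp (alpha * cos theta / 2) - 1.

(* [Lub_Rbar] takes values in [Rbar]; [Lambda_is_lub] below shows that the
   projection to [R] is the genuine supremum on the intended domain. *)
Definition Lambda (T theta : R) : R := real (Lub_Rbar (Lambda_set T theta)).

Lemma Lambda_is_lub (T theta : R) :
  1 < T -> - PI / 2 < theta < PI / 2 -> is_lub (Lambda_set T theta) (Lambda T theta).
Proof.
intros HT Hth.
assert (Hc : 0 < cos theta) by (apply cos_gt_0; lra).
assert (Hc1 : cos theta <= 1) by apply COS_bound.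
assert (H1 : Lambda_set T theta 1).
{ split; [lra|].
  pose proof (exp_ineq1_le (- (1 * cos theta / 2))) as H.
  rewrite exp_Ropp in H.
  set (e := exp (1 * cos theta / 2)) in *.
  assert (He : 0 < e) by apply exp_pos.
  assert (Hi : e * / e = 1) by (field; lra).
  nra. }
assert (Hb : forall a, Lambda_set T theta a -> a <= 16 * T / cos theta ^ 2).
{ intros a [Ha Hs].
  pose proof (exp_ineq1_le (a * cos theta / 4)) as H.
  replace (a * cos theta / 2) with (a * cos theta / 4 + a * cos theta / 4) in Hs by field.
  rewrite exp_plus in Hs.
  set (e := exp (a * cos theta / 4)) in *.
  assert (Hac : 0 < a * cos theta) by nra.
  assert (Hsq : (1 + a * cos theta / 4) * (1 + a * cos theta / 4) <= e * e) by nra.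
  assert (Hq : a * (a * cos theta ^ 2) < a * (16 * T)) by nra.
  apply Rmult_lt_reg_l in Hq; [|exact Ha].
  apply Rle_div_r; [nra|lra]. }
destruct (completeness (Lambda_set T theta)) as [l Hl].
- exists (16 * T / cos theta ^ 2). exact Hb.
- exists 1. exact H1.
- unfold Lambda. rewrite (is_lub_Rbar_unique _ (Finite l)); [exact Hl|].
  destruct Hl as [Hu Hm]. split.
  + exact Hu.
  + intros [r| |] Hr; simpl.
    * apply Hm. exact Hr.
    * exact I.
    * exact (Hr 1 H1).
Qed.

(* The 2x2 matrix with rows (a, b) and (c, d), acting on column vectors. *)
Definition mat2_app (a b c d : R) (p : R * R) : R * R :=
  (a * fst p + b * snd p, c * fst p + d * snd p).

Definition curve (alpha theta sigma eta u0 v0 t : R) : R * R :=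
  let p := mat2_app (cos theta) (- sin theta) (sin theta) (cos theta)
             (mat2_app sigma 0 0 eta
                (f (alpha * t) + u0 * (alpha * t),
                 g (alpha * t) + v0 * (alpha * t))) in
  (1 / alpha ^ 2 * fst p, 1 / alpha ^ 2 * snd p).

(* Main.v *)
From Stdlib Require Import Reals Lra Psatz.
From Coquelicot Require Import Coquelicot.
Require Import Defs.
Local Open Scope R_scope.

(** Undoing the rotation, the velocity of the curve has components
    [sigma * (arcsinh (alpha t) + u0) / alpha] and
    [eta * (sqrt (1 + (alpha t)^2) + v0) / alpha].  Write [T = t2 - t1] and
    [a_i = arcsinh (alpha * t_i)], so that [alpha * t_i = sinh a_i] and
    [sqrt (1 + (alpha * t_i)^2) = cosh a_i].  The velocity changes by the unit
    vector [(1, 0)], hence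
    [sigma * (a_2 - a_1) = alpha * cos theta] and
    [eta * (cosh a_2 - cosh a_1) = - alpha * sin theta].
    As [arcsinh] increases, [a_2 - a_1 = 2 h] with [h = alpha * cos theta / 2 > 0].
    The points [(sinh a_i, cosh a_i)] lie on a hyperbola, whose Minkowski chord
    length depends only on [a_2 - a_1] ([hyperbola_chord]); this gives
    [(alpha T)^2 = (alpha sin theta)^2 + (2 sinh h)^2].

    Everything follows from this identity.  From [sinh h > h] one gets [T > 1],
    so that [Lambda T theta] is a genuine supremum.  From
    [alpha T >= 2 sinh h = exp h - exp (- h) > exp h - 1] one sees that [alpha]
    belongs to the set defining [Lambda].  That set is open to the right
    ([Lambda_set_lt_Lambda]), so its members lie strictly below its supremum. *)

(** * Hyperbolic functions *)

Lemma cosh2_sinh2 (a : R) : cosh a ^ 2 - sinh a ^ 2 = 1.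
Proof.
  unfold cosh, sinh.
  assert (H : exp a * exp (- a) = 1) by (rewrite <- exp_plus, Rplus_opp_r; apply exp_0).
  lra.
Qed.

Lemma cosh_arcsinh (s : R) : cosh (arcsinh s) = sqrt (1 + s ^ 2).
Proof.
  pose proof (cosh2_sinh2 (arcsinh s)) as H.
  rewrite sinh_arcsinh in H.
  replace (1 + s ^ 2) with (cosh (arcsinh s) ^ 2) by lra.
  rewrite sqrt_pow2; [reflexivity|].
  unfold cosh.
  pose proof (exp_pos (arcsinh s)); pose proof (exp_pos (- arcsinh s)); lra.
Qed.

(** Hyperbolic rotations preserve the Minkowski form, so that the Minkowski
    length of a chord depends on [b - a] alone; centring the chord at the vertex
    of the hyperbola gives the value [2 * sinh ((b - a) / 2)]. *)
Lemma hyperbola_chord (a b : R) :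
  (sinh b - sinh a) ^ 2 = (cosh b - cosh a) ^ 2 + (2 * sinh ((b - a) / 2)) ^ 2.
Proof.
  set (m := (a + b) / 2); set (h := (b - a) / 2).
  replace b with (m + h) by (unfold m, h; field).
  replace a with (m + - h) by (unfold m, h; field).
  unfold cosh, sinh.
  rewrite !Ropp_plus_distr, Ropp_involutive, !exp_plus.
  assert (Hm : exp m * exp (- m) = 1) by (rewrite <- exp_plus, Rplus_opp_r; apply exp_0).
  (* The two sides differ by [(exp m * exp (- m) - 1) * (exp h - exp (- h))^2]. *)
  apply Rminus_diag_uniq.
  transitivity ((exp m * exp (- m) - 1) * (exp h - exp (- h)) ^ 2).
  - field.
  - rewrite Hm; ring.
Qed.

Lemma lt_sinh (h : R) : 0 < h -> h < sinh h.
Proof.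
  intros Hh.
  destruct (MVT_cor2 sinh cosh 0 h Hh) as [c [Hc Hc']].
  { intros c _; apply derivable_pt_lim_sinh. }
  rewrite sinh_0, !Rminus_0_r in Hc.
  assert (Hs : 0 < sinh c) by (rewrite <- sinh_0; apply sinh_lt; lra).
  assert (Hp : 0 < cosh c)
    by (unfold cosh; pose proof (exp_pos c); pose proof (exp_pos (- c)); lra).
  pose proof (cosh2_sinh2 c) as H.
  assert (1 < cosh c) by nra.
  nra.
Qed.

Lemma exp_minus_1_lt_2sinh (h : R) : 0 < h -> exp h - 1 < 2 * sinh h.
Proof.
  intros Hh; unfold sinh.
  assert (exp (- h) < 1) by (rewrite <- exp_0; apply exp_increasing; lra).
  lra.
Qed.

(** * Velocity of the curve *)

Lemma is_derive_arcsinh (s : R) : is_derive arcsinh s (/ sqrt (1 + s ^ 2)).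
Proof.
  rewrite Rplus_comm; apply is_derive_Reals, derivable_pt_lim_arcsinh.
Qed.

Lemma is_derive_f (s : R) : is_derive f s (arcsinh s).
Proof.
  assert (Hp : 0 < 1 + s ^ 2) by nra.
  assert (Hq : sqrt (1 + s ^ 2) <> 0) by (apply Rgt_not_eq, sqrt_lt_R0, Hp).
  pose proof (is_derive_arcsinh s) as Ha.
  unfold f; auto_derive; replace (s * (s * 1)) with (s ^ 2) by ring.
  - repeat split; [eexists; exact Ha | exact Hp].
  - rewrite (is_derive_unique _ _ _ Ha : Derive (fun x : R => arcsinh x) s = _); field; exact Hq.
Qed.

Lemma is_derive_g (s : R) : is_derive g s (sqrt (1 + s ^ 2)).
Proof.
  assert (Hp : 0 < 1 + s ^ 2) by nra.
  assert (Hq : sqrt (1 + s ^ 2) <> 0) by (apply Rgt_not_eq, sqrt_lt_R0, Hp).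
  pose proof (is_derive_arcsinh s) as Ha.
  unfold g; auto_derive; replace (s * (s * 1)) with (s ^ 2) by ring.
  - repeat split; [exact Hp | eexists; exact Ha].
  - rewrite (is_derive_unique _ _ _ Ha : Derive (fun x : R => arcsinh x) s = _).
    pose proof (pow2_sqrt (1 + s ^ 2) (Rlt_le _ _ Hp)) as Hs.
    apply (Rmult_eq_reg_r (2 * sqrt (1 + s ^ 2))); [|lra].
    field_simplify; [|exact Hq]. rewrite Hs; ring.
Qed.

(** Each coordinate of the curve has this form, with [p] and [q] the entries of
    a row of the rotation matrix. *)
Lemma curve_component_velocity (alpha sigma eta u0 v0 p q : R) (z : R -> R) (t l : R) :
  0 < alpha ->
  (forall s, z s = 1 / alpha ^ 2 *
      (p * (sigma * (f (alpha * s) + u0 * (alpha * s)) +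
            0 * (g (alpha * s) + v0 * (alpha * s))) +
       q * (0 * (f (alpha * s) + u0 * (alpha * s)) +
            eta * (g (alpha * s) + v0 * (alpha * s))))) ->
  is_derive z t l ->
  p * (sigma * (arcsinh (alpha * t) + u0)) +
  q * (eta * (sqrt (1 + (alpha * t) ^ 2) + v0)) = l * alpha.
Proof.
  intros Ha Hz Hl.
  apply (is_derive_ext _ _ _ _ Hz), is_derive_unique in Hl.
  rewrite <- Hl; symmetry.
  apply (Rmult_eq_reg_r (/ alpha)); [|apply Rinv_neq_0_compat; lra].
  rewrite Rmult_assoc, Rinv_r, Rmult_1_r by lra.
  apply is_derive_unique.
  pose proof (is_derive_f (alpha * t)) as Hf.
  pose proof (is_derive_g (alpha * t)) as Hg.
  auto_derive.
  - repeat split; eexists; eassumption.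
  - rewrite (is_derive_unique _ _ _ Hf : Derive (fun x : R => f x) (alpha * t) = _).
    rewrite (is_derive_unique _ _ _ Hg : Derive (fun x : R => g x) (alpha * t) = _).
    field; lra.
Qed.

Lemma rotation_solve (c s p q r : R) :
  c ^ 2 + s ^ 2 = 1 -> c * p + - s * q = r -> s * p + c * q = 0 ->
  p = r * c /\ q = - (r * s).
Proof.
  intros H1 H2 H3; split.
  - transitivity ((c ^ 2 + s ^ 2) * p); [rewrite H1; ring|].
    transitivity (c * (c * p + - s * q) + s * (s * p + c * q)); [ring|].
    rewrite H2, H3; ring.
  - transitivity ((c ^ 2 + s ^ 2) * q); [rewrite H1; ring|].
    transitivity (c * (s * p + c * q) - s * (c * p + - s * q)); [ring|].
    rewrite H2, H3; ring.
Qed.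

(** * The supremum is not attained *)

(** The defining inequality is strict between continuous functions of [alpha],
    so that it persists slightly to the right of any member. *)
Lemma Lambda_set_lt_Lambda (T theta alpha : R) :
  1 < T -> - PI / 2 < theta < PI / 2 -> Lambda_set T theta alpha ->
  alpha < Lambda T theta.
Proof.
  intros HT Hth [Ha Hs].
  set (k := fun a => a * T - exp (a * cos theta / 2)).
  assert (Hk : continuous k alpha).
  { apply (ex_derive_continuous k); unfold k; auto_derive; exact I. }
  destruct (Hk (fun r => -1 < r)) as [eps Heps].
  { apply (open_gt (-1)); unfold k; lra. }
  pose proof (cond_pos eps) as He.
  assert (Hin : Lambda_set T theta (alpha + eps / 2)).
  { split; [lra|].
    assert (Hb : -1 < k (alpha + eps / 2)).
    { apply Heps.
      apply (norm_compat1 (V := R_NormedModule)).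
      change (Rabs (alpha + eps / 2 - alpha) < eps).
      replace (alpha + eps / 2 - alpha) with (eps / 2) by ring.
      rewrite Rabs_pos_eq; lra. }
    unfold k in Hb; lra. }
  pose proof (proj1 (Lambda_is_lub T theta HT Hth) _ Hin); lra.
Qed.

(** * The bound *)

(** With [s_i = alpha * t_i], the hypotheses are the two components of the
    velocity change of the curve, once [sigma = 1] is known. The points
    [(s_i, sqrt (1 + s_i ^ 2))] lie on the hyperbola, and the conclusion is its
    chord identity. *)
Lemma chord_of_velocity_change (alpha theta eta s1 s2 : R) :
  eta = 1 \/ eta = -1 ->
  arcsinh s2 - arcsinh s1 = alpha * cos theta ->
  eta * (sqrt (1 + s2 ^ 2) - sqrt (1 + s1 ^ 2)) = - (alpha * sin theta) ->
  (s2 - s1) ^ 2 =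
  (alpha * sin theta) ^ 2 + (2 * sinh (alpha * cos theta / 2)) ^ 2.
Proof.
  intros Heta HA HS.
  pose proof (hyperbola_chord (arcsinh s1) (arcsinh s2)) as H.
  rewrite !sinh_arcsinh, !cosh_arcsinh, HA in H.
  rewrite H; f_equal.
  destruct Heta; subst eta; nra.
Qed.

Theorem proposition2p4
  (u v alpha theta sigma eta u0 v0 t1 t2 deltax deltay : R) (x y : R -> R)
  (Halpha : 0 < alpha)
  (Htheta : - PI / 2 < theta < PI / 2)
  (Hsigma : sigma = 1 \/ sigma = -1)
  (Heta : eta = 1 \/ eta = -1)
  (Ht : t1 < t2)
  (Hcurve : forall t : R, (x t, y t) = curve alpha theta sigma eta u0 v0 t)
  (Hstart : is_derive x t1 u /\ is_derive y t1 v)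
  (Hend : is_derive x t2 (u + 1) /\ is_derive y t2 v)
  (Hdisp : (x t2 - x t1, y t2 - y t1) = (deltax, deltay)) :
  alpha < Lambda (t2 - t1) theta.
Proof.
  assert (Hx : forall t l, is_derive x t l ->
    cos theta * (sigma * (arcsinh (alpha * t) + u0)) +
    - sin theta * (eta * (sqrt (1 + (alpha * t) ^ 2) + v0)) = l * alpha).
  { intros t l; apply curve_component_velocity; [exact Halpha|].
    intros s; exact (f_equal fst (Hcurve s)). }
  assert (Hy : forall t l, is_derive y t l ->
    sin theta * (sigma * (arcsinh (alpha * t) + u0)) +
    cos theta * (eta * (sqrt (1 + (alpha * t) ^ 2) + v0)) = l * alpha).
  { intros t l; apply curve_component_velocity; [exact Halpha|].
    intros s; exact (f_equal snd (Hcurve s)). }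
  destruct Hstart as [Hx1%Hx Hy1%Hy], Hend as [Hx2%Hx Hy2%Hy].
  assert (Hc : 0 < cos theta) by (apply cos_gt_0; lra).
  assert (Hcs : cos theta ^ 2 + sin theta ^ 2 = 1)
    by (pose proof (sin2_cos2 theta) as H; unfold Rsqr in H; lra).
  destruct (rotation_solve (cos theta) (sin theta)
    (sigma * (arcsinh (alpha * t2) - arcsinh (alpha * t1)))
    (eta * (sqrt (1 + (alpha * t2) ^ 2) - sqrt (1 + (alpha * t1) ^ 2)))
    alpha Hcs ltac:(lra) ltac:(lra)) as [HA HS].
  assert (Hs : alpha * t1 < alpha * t2) by (apply Rmult_lt_compat_l; lra).
  assert (HA' : arcsinh (alpha * t2) - arcsinh (alpha * t1) = alpha * cos theta).
  { (* [arcsinh] increases and [cos theta > 0], which excludes [sigma = -1]. *)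
    pose proof (arcsinh_lt _ _ Hs).
    pose proof (Rmult_lt_0_compat _ _ Halpha Hc).
    destruct Hsigma; subst sigma; lra. }
  pose proof (chord_of_velocity_change _ _ _ _ _ Heta HA' HS) as Hchord.
  set (h := alpha * cos theta / 2) in *.
  assert (Hh : 0 < h) by (unfold h; nra).
  pose proof (lt_sinh h Hh) as Hsinh.
  apply Lambda_set_lt_Lambda; [|exact Htheta|split; [exact Halpha|]].
  - (* The velocity change has length 1: compare with [cos^2 + sin^2 = 1]. *)
    assert (Hlt : alpha ^ 2 < (alpha * t2 - alpha * t1) ^ 2).
    { assert (alpha ^ 2 = (alpha * sin theta) ^ 2 + (2 * h) ^ 2).
      { transitivity (alpha ^ 2 * (cos theta ^ 2 + sin theta ^ 2));
          [rewrite Hcs; ring | unfold h; field]. }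
      nra. }
    assert (alpha < alpha * t2 - alpha * t1) by nra.
    apply (Rmult_lt_reg_l alpha); lra.
  - fold h.
    pose proof (exp_minus_1_lt_2sinh h Hh).
    assert (2 * sinh h <= alpha * t2 - alpha * t1).
    { apply Rsqr_incr_0_var; unfold Rsqr; nra. }
    lra.
Qed.
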